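(* Let $A$ be a finite set, let $I$ be an infinite set, let $\mathbb{L}$ be a sublattice of the lattice of equivalence relations on $A$, and let $(\mathbf{B}_i)_{i\in I}$ be a family of algebras with universe $A$ such that for each $i\in I$, $\mathbf{B}_i$ has a Mal'cev term $d_i$ and $\mathrm{Con}(\mathbf{B}_i)=\mathbb{L}$, and for all $i,j\in I$ with $i\ne j$, $\mathbf{B}_i$ and $\mathbf{B}_j$ are not commutator equivalent. Then $|I|\le\aleph_0$, and there are $\delta,\varepsilon\in\mathbb{L}$ with $0<\varepsilon\le\delta<1$ such that $\mathbb{L}$ is the union of the two intervals $I[0,\delta]\cup I[\varepsilon,1]$.
   Context: Algebras are universal algebras (the $\mathbf{B}_i$ may have different fundamental operations). $\mathbb{N}$ denotes the set of positive integers. A Mal'cev term is a ternary term $d$ with $d(x,x,y)=y=d(y,x,x)$ identically. $0$ and $1$ denote the least and greatest element of $\mathbb{L}$, and $I[\alpha,\beta]=\{\gamma\in\mathbb{L} : \alpha\le\gamma\le\beta\}$. Higher commutators (Bulatov). Let $\mathbf{A}$ be an algebra, $n\in\mathbb{N}$, and $\alpha_1,\ldots,\alpha_n\in\mathrm{Con}(\mathbf{A})$. The $n$-ary commutator $[\alpha_1,\ldots,\alpha_n]_{\mathbf{A}}$ is the smallest congruence $\eta$ of $\mathbf{A}$ with the following property: for every polynomial operation $f$ of $\mathbf{A}$ (with its variables divided into $n$ blocks) and all tuples $\mathbf{a}_1,\mathbf{b}_1,\ldots,\mathbf{a}_n,\mathbf{b}_n$ of elements of $A$ of the corresponding lengths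 such that $\mathbf{a}_i$ and $\mathbf{b}_i$ are componentwise congruent modulo $\alpha_i$ for each $i$, if $f(\mathbf{x}_1,\ldots,\mathbf{x}_{n-1},\mathbf{a}_n)\equiv_\eta f(\mathbf{x}_1,\ldots,\mathbf{x}_{n-1},\mathbf{b}_n)$ for all $(\mathbf{x}_1,\ldots,\mathbf{x}_{n-1})\in(\{\mathbf{a}_1,\mathbf{b}_1\}\times\cdots\times\{\mathbf{a}_{n-1},\mathbf{b}_{n-1}\})\setminus\{(\mathbf{b}_1,\ldots,\mathbf{b}_{n-1})\}$, then $f(\mathbf{b}_1,\ldots,\mathbf{b}_{n-1},\mathbf{a}_n)\equiv_\eta f(\mathbf{b}_1,\ldots,\mathbf{b}_{n-1},\mathbf{b}_n)$. (For $n=1$ this gives $[\alpha_1]_{\mathbf{A}}=\alpha_1$.) Commutator equivalence. The commutator structure of $\mathbf{A}$ is $(\mathrm{Con}(\mathbf{A}),\wedge,\vee,(f_i)_{i\in\mathbb{N}})$ with $f_i:(\mathrm{Con}(\mathbf{A}))^i\to\mathrm{Con}(\mathbf{A})$, $(\alpha_1,\ldots,\alpha_i)\mapsto[\alpha_1,\ldots,\alpha_i]_{\mathbf{A}}$. Two algebras are commutator equivalent if they have the same commutator structure. *)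

(* Defs.v *)
(* The finite-type libraries are imported after the classical ones so that
   [set0], [set x | P], [subsetP] refer to finite sets. *)
From HB Require Import structures.
From mathcomp Require Import boolp classical_sets cardinality.
From mathcomp Require Import all_boot all_order.

Set Implicit Arguments.
Unset Strict Implicit.
Unset Printing Implicit Defensive.

Import Order.LTheory.
Local Open Scope order_scope.

Section EquivalenceLattice.
Variable A : finType.

Definition is_equivalence (r : {set A * A}) : bool :=
  [&& [forall x, (x, x) \in r],
      [forall x, forall y, ((x, y) \in r) ==> ((y, x) \in r)]
    & [forall x, forall y, forall z,
        ((x, y) \in r) && ((y, z) \in r) ==> ((x, z) \in r)]].

Record equivalence := Equivalence {
  graph : {set A * A};
  graphP : is_equivalence graph }.

HB.instance Definition _ := [isSub for graph].
HB.instance Definition _ := [Finite of equivalence by <:].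

Definition eqv_rel (t : equivalence) : rel A := fun x y => (x, y) \in graph t.
Local Coercion eqv_rel : equivalence >-> rel.

Lemma eqv_refl (t : equivalence) : reflexive t.
Proof. by case: t => r p x; case/and3P: (p) => /forallP/(_ x). Qed.

Lemma eqv_sym (t : equivalence) : symmetric t.
Proof.
suff h x y : t x y -> t y x by move=> x y; apply/idP/idP; apply: h.
by case: t => r p; case/and3P: (p) => _ /'forall_'forall_implyP/(_ x y).
Qed.

Lemma eqv_trans (t : equivalence) : transitive t.
Proof.
move=> y x z; case: t => r p; rewrite /eqv_rel /= => xy yz.
case/and3P: p => _ _ /'forall_'forall_'forall_implyP/(_ x y z).
by rewrite xy yz; apply.
Qed.

Lemma is_equivalenceP (e : rel A) :
  reflexive e -> symmetric e -> transitive e ->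
  is_equivalence [set u | e u.1 u.2].
Proof.
move=> er es et; apply/and3P; split.
- by apply/forallP => x; rewrite inE er.
- by apply/'forall_'forall_implyP => x y; rewrite !inE /= es.
- apply/'forall_'forall_'forall_implyP => x y z; rewrite !inE /= => /andP[].
  exact: et.
Qed.

Definition mk_eqv (e : rel A) er es et : equivalence :=
  Equivalence (@is_equivalenceP e er es et).

Lemma mk_eqvE (e : rel A) er es et x y : @mk_eqv e er es et x y = e x y.
Proof. by rewrite /eqv_rel inE. Qed.

Definition eqv_le (s t : equivalence) : bool := graph s \subset graph t.

Lemma eqv_leP (s t : equivalence) :
  reflect (forall x y, s x y -> t x y) (eqv_le s t).
Proof. by apply: (iffP subsetP) => h => [x y|[x y]]; apply: h. Qed.

Fact eqv_le_refl : reflexive eqv_le.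
Proof. by move=> t; apply: subxx. Qed.
Fact eqv_le_anti : antisymmetric eqv_le.
Proof. by move=> s t; rewrite /eqv_le -eqEsubset => /eqP/val_inj. Qed.
Fact eqv_le_trans : transitive eqv_le.
Proof. by move=> t s u; apply: subset_trans. Qed.

Fact equivalence_display : Order.disp_t. Proof. exact: Order.Disp tt tt. Qed.

HB.instance Definition _ := Order.Le_isPOrder.Build equivalence_display
  equivalence eqv_le_refl eqv_le_anti eqv_le_trans.

Section Meet.
Variables s t : equivalence.
Let e : rel A := fun x y => s x y && t x y.
Let er : reflexive e. Proof. by move=> x; rewrite /e !eqv_refl. Qed.
Let es : symmetric e.
Proof. by move=> x y; rewrite /e (eqv_sym s) (eqv_sym t). Qed.
Let et : transitive e.
Proof.
by move=> y x z /andP[s1 t1] /andP[s2 t2]; rewrite /e (eqv_trans s1 s2) (eqv_trans t1 t2).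
Qed.
Definition eqv_meet := mk_eqv er es et.
Lemma eqv_meetE x y : eqv_meet x y = s x y && t x y.
Proof. exact: mk_eqvE. Qed.
End Meet.

Section Join.
Variables s t : equivalence.
Let u : rel A := fun x y => s x y || t x y.
Let es : symmetric (connect u).
Proof.
apply: sym_connect_sym => x y.
by rewrite /u (eqv_sym s) (eqv_sym t).
Qed.
Definition eqv_join := mk_eqv (@connect0 _ u) es (@connect_trans _ u).
Lemma eqv_joinE x y : eqv_join x y = connect u x y.
Proof. exact: mk_eqvE. Qed.
End Join.

Fact eqv_lexI (r s t : equivalence) :
  (r <= eqv_meet s t) = (r <= s) && (r <= t).
Proof.
apply/eqv_leP/andP => [h|[/eqv_leP hs /eqv_leP ht] x y rxy].
  by split; apply/eqv_leP => x y /h; rewrite eqv_meetE => /andP[].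
by rewrite eqv_meetE hs ?ht.
Qed.

Fact eqv_leUx (r s t : equivalence) :
  (eqv_join r s <= t) = (r <= t) && (s <= t).
Proof.
apply/eqv_leP/andP => [h|[/eqv_leP hr /eqv_leP hs] x y].
  by split; apply/eqv_leP => x y k; apply: h;
    rewrite eqv_joinE connect1 // k ?orbT.
rewrite eqv_joinE => /connectP[p + ->].
elim: p x => [|z p IHp] x /=; first by rewrite eqv_refl.
case/andP=> xz /IHp; apply: eqv_trans.
by case/orP: xz => [/hr|/hs].
Qed.

HB.instance Definition _ :=
  Order.POrder_isMeetSemilattice.Build equivalence_display equivalence eqv_lexI.
HB.instance Definition _ :=
  Order.POrder_isJoinSemilattice.Build equivalence_display equivalence eqv_leUx.

Let eq_sym_rel : symmetric (@eq_op A : rel A).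
Proof. by move=> x y; apply: eq_sym. Qed.
Let eq_trans_rel : transitive (@eq_op A : rel A).
Proof. by move=> y x z /eqP-> /eqP->. Qed.
Definition eqv_bot := mk_eqv (@eqxx A) eq_sym_rel eq_trans_rel.
Definition eqv_top : equivalence :=
  @mk_eqv (fun _ _ => true) (fun=> erefl) (fun _ _ => erefl) (fun _ _ _ _ => id).

Fact eqv_le0x (t : equivalence) : eqv_bot <= t.
Proof. by apply/eqv_leP => x y; rewrite mk_eqvE => /eqP->; apply: eqv_refl. Qed.
Fact eqv_lex1 (t : equivalence) : t <= eqv_top.
Proof. by apply/eqv_leP => x y _; rewrite mk_eqvE. Qed.

HB.instance Definition _ :=
  Order.hasBottom.Build equivalence_display equivalence eqv_le0x.
HB.instance Definition _ :=
  Order.hasTop.Build equivalence_display equivalence eqv_lex1.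

Lemma meetE (s t : equivalence) x y : (s `&` t) x y = s x y && t x y.
Proof. exact: eqv_meetE. Qed.

Lemma joinE (s t : equivalence) x y :
  (s `|` t) x y = connect (fun a b => s a b || t a b) x y.
Proof. exact: eqv_joinE. Qed.

Lemma leP_eqv (s t : equivalence) :
  reflect (forall x y, s x y -> t x y) (s <= t).
Proof. exact: eqv_leP. Qed.

Lemma meets_eqvP (P : pred equivalence) x y :
  reflect (forall t, P t -> t x y) ((\meet_(t | P t) t) x y).
Proof.
apply: (iffP idP) => [h t Pt|h].
  have /leP_eqv : \meet_(t | P t) t <= t by apply: meets_inf.
  exact.
elim/big_ind: _ => [|s t hs ht|t]; last exact: h.
- by apply: etrans (mk_eqvE _ _ _ x y) _.
- by rewrite meetE hs ht.
Qed.

Definition sublattice (L : {set equivalence}) : Prop :=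
  [/\ L != set0, meet_closed L & join_closed L].

Definition bot_of (L : {set equivalence}) : equivalence := \meet_(g in L) g.
Definition top_of (L : {set equivalence}) : equivalence := \join_(g in L) g.

Lemma bot_of_least (L : {set equivalence}) : sublattice L ->
  bot_of L \in L /\ {in L, forall g, bot_of L <= g}.
Proof.
case=> /set0Pn[g0 Lg0] LI _; split=> [|g Lg]; last exact: meets_inf.
suff h s : all [in L] s -> {in L, forall g, g `&` \meet_(t <- s) t \in L}.
  have -> : bot_of L = g0 `&` \meet_(g in L) g.
    by rewrite meet_r //; apply: meets_inf.
  by rewrite -big_enum; apply: h => //; apply/allP => g; rewrite mem_enum.
elim: s => [|t s IHs] /=; first by move=> _ g Lg; rewrite big_nil meetx1.
by case/andP=> Lt /IHs h g Lg; rewrite big_cons LI ?h.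
Qed.

Lemma top_of_greatest (L : {set equivalence}) : sublattice L ->
  top_of L \in L /\ {in L, forall g, g <= top_of L}.
Proof.
case=> /set0Pn[g0 Lg0] _ LU; split=> [|g Lg]; last exact: joins_sup.
suff h s : all [in L] s -> {in L, forall g, g `|` \join_(t <- s) t \in L}.
  have -> : top_of L = g0 `|` \join_(g in L) g.
    by rewrite join_r //; apply: joins_sup.
  by rewrite -big_enum; apply: h => //; apply/allP => g; rewrite mem_enum.
elim: s => [|t s IHs] /=; first by move=> _ g Lg; rewrite big_nil joinx0.
by case/andP=> Lt /IHs h g Lg; rewrite big_cons LU ?h.
Qed.

Definition interval (L : {set equivalence}) (a b : equivalence) :
  {set equivalence} := [set g in L | a <= g <= b].

End EquivalenceLattice.

Coercion eqv_rel : equivalence >-> rel.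

Record algebra (A : Type) := Algebra {
  opsym : Type;
  arity : opsym -> nat;
  op : forall s : opsym, (arity s).-tuple A -> A }.

Section Terms.
Variables (A : Type) (B : algebra A).

Inductive term (X : Type) : Type :=
  | Var of X
  | App (s : opsym B) of 'I_(arity s) -> term X.

Fixpoint eval (X : Type) (v : X -> A) (t : term X) : A :=
  match t with
  | Var x => v x
  | App s args => op [tuple eval v (args i) | i < arity s]
  end.

(* A polynomial operation is a term operation of B expanded by all constants:
   the leaf [inr c] stands for the element c. *)
Definition polynomial (X : Type) : Type := term (X + A).

Definition peval (X : Type) (p : polynomial X) (v : X -> A) : A :=
  eval (fun l => match l with inl x => v x | inr c => c end) p.

Definition has_malcev_term : Prop :=
  exists d : term 'I_3, forall x y : A,
    eval (tnth [tuple x; x; y]) d = y /\ eval (tnth [tuple y; x; x]) d = y.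

End Terms.

Section Commutators.
Variables (A : finType) (B : algebra A).

Definition congruence (t : equivalence A) : Prop :=
  forall (s : opsym B) (x y : (arity s).-tuple A),
    (forall i, t (tnth x i) (tnth y i)) -> t (op x) (op y).

Definition Con : {set equivalence A} := [set t | `[< congruence t >]].

(* The variables of a polynomial in n blocks of lengths k 0, ..., k (n - 1):
   the pair (i, j) is the j-th variable of the i-th block. *)
Definition blocks n (k : 'I_n -> nat) : Type := {i : 'I_n & 'I_(k i)}.

(* The assignment giving block i the tuple b i if i \in S and a i otherwise. *)
Definition vertex n (k : 'I_n -> nat) (a b : forall i, (k i).-tuple A)
    (S : {set 'I_n}) : blocks k -> A :=
  fun v => tnth (if tag v \in S then b (tag v) else a (tag v)) (tagged v).

(* The tuples (x_1, ..., x_n) are indexed by the set S of blocks i at which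
   b_i has been chosen, so (b_1, ..., b_n) is excluded as a choice, not as a
   value: the remaining choices stay required when some a_i equals b_i. *)
Definition centralizes n (alpha : 'I_n.+1 -> equivalence A)
    (eta : equivalence A) : Prop :=
  forall (k : 'I_n.+1 -> nat) (f : polynomial B (blocks k))
         (a b : forall i, (k i).-tuple A),
    (forall i j, alpha i (tnth (a i) j) (tnth (b i) j)) ->
    (forall S : {set 'I_n.+1}, S \proper [set~ ord_max] ->
       eta (peval f (vertex a b S)) (peval f (vertex a b (ord_max |: S)))) ->
    eta (peval f (vertex a b [set~ ord_max])) (peval f (vertex a b [set: 'I_n.+1])).

Definition commutator n (alpha : 'I_n.+1 -> equivalence A) : equivalence A :=
  \meet_(eta in Con | `[< centralizes alpha eta >]) eta.

Lemma commutator_smallest n (alpha : 'I_n.+1 -> equivalence A) :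
  [/\ commutator alpha \in Con, centralizes alpha (commutator alpha)
    & forall eta, eta \in Con -> centralizes alpha eta ->
        commutator alpha <= eta].
Proof.
split.
- rewrite inE; apply/asboolP => s x y xy; apply/meets_eqvP => t /= /andP[].
  rewrite inE => /asboolP ct ht; apply: (ct) => i.
  by apply: (elimT (meets_eqvP _ _ _) (xy i)); rewrite /= ht andbT inE; apply/asboolP.
- move=> k f a b ab h; apply/meets_eqvP => t /= /andP[ct /asboolP zt].
  apply: (zt) => // S pS; apply: (elimT (meets_eqvP _ _ _) (h S pS)).
  by rewrite /= ct; apply/asboolP.
- by move=> eta ceta zeta; apply: meets_inf; rewrite ceta; apply/asboolP.
Qed.

End Commutators.

(* The meet and join of a congruence lattice are its infimum and supremum for
   inclusion, hence are determined by the set of congruences. *)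
Definition commutator_equivalent (A : finType) (B B' : algebra A) : Prop :=
  Con B = Con B' /\
  forall n (alpha : 'I_n.+1 -> equivalence A),
    (forall i, alpha i \in Con B) -> commutator B alpha = commutator B' alpha.

(* Main.v *)
Require Import Defs.
From mathcomp Require Import boolp classical_sets cardinality filter.
From mathcomp Require Import all_boot all_order zify.

Set Implicit Arguments.
Unset Strict Implicit.
Unset Printing Implicit Defensive.

Import Order.LTheory.

(** Write [[w]] for the higher commutator of a word [w] of congruences. For an
    algebra with a Mal'cev term, [[w] <= eta] means that every polynomial cube
    over [w] that is constant off its top vertex has a top value congruent to
    this constant modulo [eta] (lemma [centralizes_absorbing]). This makes the
    commutator symmetric and decreasing in the word by reindexing cubes
    ([wcomm_reindex]), distributive over joins by cutting each edge into two
    ([wcomm_join]), and it allows a letter [t = [t, t]] to be repeated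
    ([wcomm_dup]). A sequence of operations with these properties is called
    admissible; the rest of the proof is about admissible sequences.

    Countability. The words with [[w] <= m] are upward closed for the order
    given by the multiplicities of letters, so by Dickson's lemma finitely many
    words determine them; there are countably many finite sets of words
    ([countable_family]).

    Splitting. By compactness (a limit along a non-principal ultrafilter,
    [L] being finite), infinitely many distinct admissible sequences accumulate
    at an admissible sequence [f], and arbitrarily long words are needed to tell
    [f] from the members of the family. A least such word shows that some join
    irreducible [y] with [[y, y] <> y] satisfies [[y, ..., y] <= m] for no
    number of letters ([agreement_or_letter]). Fix a word [v] containing [y] for
    which the set [Q] of the letters [p] with [[p, ..., p, v] <= m] for no
    number of [p] is nonempty and as small as possible. By distributivity
    [L :\: Q] is an ideal [I[0, delta]]; by minimality, all of [Q] can be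
    added to [v] without the commutator falling below [m], so [Q] has a lower
    bound that is not below [m]. With the greatest lower bound [epsilon] of [Q],
    [L] is the union of [I[0, delta]] and [I[epsilon, 1]]; the letter [y]
    excludes the only case in which the bounds cannot be chosen with
    [epsilon <= delta] ([frequent_letter_splits]). *)

(** * Subuniverses of powers and Mal'cev operations *)

Section Subuniverses.
Variables (A : finType) (B : algebra A).
Implicit Types (t : equivalence A) (x y z : A).
Local Open Scope order_scope.

Definition op_closed (W : Type) (Q : (W -> A) -> Prop) : Prop :=
  forall (s : opsym B) (g : 'I_(arity s) -> W -> A),
    (forall j, Q (g j)) -> Q (fun w => op [tuple g j w | j < arity s]).

Inductive generated (W : Type) (G : (W -> A) -> Prop) : (W -> A) -> Prop :=
  | gen_base g of G g : generated G g
  | gen_const c : generated G (fun=> c)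
  | gen_op (s : opsym B) (g : 'I_(arity s) -> W -> A) of (forall j, generated G (g j)) :
      generated G (fun w => op [tuple g j w | j < arity s]).

Lemma generated_closed W (G : (W -> A) -> Prop) : op_closed (generated G).
Proof. by move=> s g; apply: gen_op. Qed.

Lemma generated_comp W W' (phi : W' -> W) (G : (W -> A) -> Prop)
    (G' : (W' -> A) -> Prop) :
  (forall g, G g -> generated G' (g \o phi)) ->
  forall g, generated G g -> generated G' (g \o phi).
Proof.
move=> GG' g; elim=> [{}g /GG' //|c|s {}g _ IH]; first exact: gen_const.
exact: (gen_op IH).
Qed.

Lemma closed_eval W (Q : (W -> A) -> Prop) X (v : X -> W -> A) (p : term B X) :
  op_closed Q -> (forall i : X, Q (v i)) -> Q (fun w => eval (v^~ w) p).
Proof. by move=> cQ vQ; elim: p => [x|s args IH] /=; [apply: vQ | apply: cQ]. Qed.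

(** Instead of a term, [d] comes with closure of every subuniverse of every
    power, which covers congruences, compatible relations and the generated
    subuniverses alike. *)
Definition malcev_operation (d : A -> A -> A -> A) : Prop :=
  [/\ forall x y, d x x y = y, forall x y, d y x x = y
    & forall W (Q : (W -> A) -> Prop), op_closed Q ->
        forall g1 g2 g3, Q g1 -> Q g2 -> Q g3 ->
          Q (fun w => d (g1 w) (g2 w) (g3 w))].

Lemma malcev_term_operation :
  has_malcev_term B -> exists d, malcev_operation d.
Proof.
case=> p pP; exists (fun x y z => eval (tnth [tuple x; y; z]) p).
split=> [x y|x y|W Q cQ g1 g2 g3 Q1 Q2 Q3]; [by case: (pP x y)..|].
have -> : (fun w => eval (tnth [tuple g1 w; g2 w; g3 w]) p)
        = (fun w => eval ((tnth [tuple g1; g2; g3])^~ w) p).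
  apply/funext=> w; congr (eval _ p); apply/funext.
  by case=> [[|[|[|i]]]] //= ilt; rewrite !(tnth_nth g1) !(tnth_nth (g1 w)).
apply: closed_eval => //.
by case=> [[|[|[|i]]]] //= ilt; rewrite (tnth_nth g1).
Qed.

Lemma congruence_closed t :
  congruence B t -> op_closed (fun g : bool -> A => t (g false) (g true)).
Proof. by move=> ct s g tg; apply: ct => j; rewrite !tnth_mktuple. Qed.

Lemma congruence_generated t W (G : (W -> A) -> Prop) (v w : W) :
    congruence B t -> (forall g, G g -> t (g v) (g w)) ->
  forall g, generated G g -> t (g v) (g w).
Proof.
move=> ct Gt g; elim=> [{}g /Gt //|c|s {}g _ IH]; first exact: eqv_refl.
by apply: ct => j; rewrite !tnth_mktuple.
Qed.

Section Malcev.
Variables (d : A -> A -> A -> A) (dP : malcev_operation d).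

Lemma malcev_congruence t x1 x2 x3 y1 y2 y3 : congruence B t ->
  t x1 y1 -> t x2 y2 -> t x3 y3 -> t (d x1 x2 x3) (d y1 y2 y3).
Proof.
case: dP => _ _ dcl /congruence_closed /dcl h h1 h2 h3.
pose pr (x y : A) b := if b then y else x.
exact: (h (pr x1 y1) (pr x2 y2) (pr x3 y3)).
Qed.

Lemma malcev_relation (R : A -> A -> Prop) x1 x2 x3 y1 y2 y3 :
  op_closed (fun g : bool -> A => R (g false) (g true)) ->
  R x1 y1 -> R x2 y2 -> R x3 y3 -> R (d x1 x2 x3) (d y1 y2 y3).
Proof.
case: dP => _ _ dcl /dcl h h1 h2 h3.
pose pr (x y : A) b := if b then y else x.
exact: (h (pr x1 y1) (pr x2 y2) (pr x3 y3)).
Qed.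

(** Symmetry and transitivity come from the Mal'cev identities: [(y, x)] is
    [d] of [(x, x), (x, y), (y, y)] and [(x, z)] is [d] of [(x, y), (y, y),
    (y, z)]. *)
Lemma reflexive_closed_congruence (R : A -> A -> Prop) :
  (forall x, R x x) -> op_closed (fun g : bool -> A => R (g false) (g true)) ->
  exists2 t : equivalence A, congruence B t & forall x y, t x y <-> R x y.
Proof.
move=> Rr Rcl; case: (dP) => d1 d2 _.
have Rs x y : R x y -> R y x.
  move=> Rxy; have := malcev_relation Rcl (Rr x) Rxy (Rr y).
  by rewrite d1 d2.
have Rt x y z : R x y -> R y z -> R x z.
  move=> Rxy Ryz; have := malcev_relation Rcl Rxy (Rr y) Ryz.
  by rewrite d1 d2.
pose e : rel A := fun x y => `[< R x y >].
have er : reflexive e by move=> x; apply/asboolP.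
have es : symmetric e by move=> x y; apply/asboolP/asboolP; apply: Rs.
have et : transitive e.
  by move=> y x z /asboolP Rxy /asboolP Ryz; apply/asboolP; apply: Rt Ryz.
exists (mk_eqv er es et) => [s x y xy|x y]; rewrite mk_eqvE; last first.
  by split=> /asboolP.
apply/asboolP; pose g j b := if b then tnth y j else tnth x j.
have tupE (u : (arity s).-tuple A) : [tuple tnth u j | j < arity s] = u.
  by apply: eq_from_tnth => j; rewrite tnth_mktuple.
have /= := Rcl s g; rewrite !tupE; apply=> j; have := xy j.
by rewrite mk_eqvE => /asboolP.
Qed.

(** The relational product of two congruences is reflexive and compatible,
    hence already a congruence. *)
Lemma join_congruence_comp (s t : equivalence A) x y :
  congruence B s -> congruence B t -> (s `|` t) x y ->
  exists2 z, s x z & t z y.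
Proof.
move=> cs ct.
pose R x y := exists2 z, s x z & t z y.
have Rr z : R z z by exists z; apply: eqv_refl.
have Rcl : op_closed (fun g : bool -> A => R (g false) (g true)).
  move=> o g /= Rg.
  have /choice[h hP] : forall j, exists z, s (g j false) z && t z (g j true).
    by move=> j; case: (Rg j) => z sz tz; exists z; rewrite sz.
  exists (op [tuple h j | j < arity o]).
    by apply: cs => j; rewrite !tnth_mktuple; case/andP: (hP j).
  by apply: ct => j; rewrite !tnth_mktuple; case/andP: (hP j).
have [u cu uR] := reflexive_closed_congruence Rr Rcl.
suff /leP_eqv h : s `|` t <= u by move=> /h /uR.
rewrite leUx; apply/andP; split; apply/leP_eqv => a b ab; apply/uR.
  by exists b => //; apply: eqv_refl.
by exists a => //; apply: eqv_refl.
Qed.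

End Malcev.

Lemma malcev_modular (s t u : equivalence A) : has_malcev_term B ->
    congruence B s -> congruence B t -> s <= u ->
  u `&` (s `|` t) <= s `|` (u `&` t).
Proof.
move=> /malcev_term_operation[d dP] cs ct /leP_eqv su.
apply/leP_eqv => x y; rewrite meetE => /andP[uxy].
case/(join_congruence_comp dP cs ct) => z sxz tzy.
have /leP_eqv sj : s <= s `|` (u `&` t) by apply: leUl.
have /leP_eqv tj : u `&` t <= s `|` (u `&` t) by apply: leUr.
apply: (eqv_trans (sj _ _ sxz)); apply: tj; rewrite meetE tzy andbT.
by apply: (eqv_trans _ uxy); rewrite eqv_sym su.
Qed.

End Subuniverses.

(** * Commutators of words of congruences *)

Section Cubes.
Variables (A : finType) (B : algebra A).
Local Open Scope order_scope.
Implicit Types (w : seq (equivalence A)) (S : nat -> bool) (t eta : equivalence A).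

Definition edge w (g : (nat -> bool) -> A) : Prop :=
  exists i x y, [/\ (i < size w)%N, nth \bot w i x y
                  & g = fun S => if S i then y else x].

(** The families [S |-> f(x_1, ..., x_n)], where [f] is a polynomial and
    [x_i] is [b_i] or [a_i] according to [S i], form the subuniverse generated
    by the edges and the constants. Vertices are indexed by functions on [nat]
    of which only the values below [size w] matter, so that words of different
    lengths share one type of vertices. *)
Definition cubes w : ((nat -> bool) -> A) -> Prop := generated B (edge w).

Definition full w S : bool := all S (iota 0 (size w)).

(** For [eta] a congruence of a Mal'cev algebra this is the centralizing
    condition; unlike that condition it is visibly monotone in [eta]. *)
Definition absorbing w eta : Prop :=
  forall h c, cubes w h -> (forall S, ~~ full w S -> h S = c) ->
    eta c (h xpredT).

Definition wcomm w : equivalence A :=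
  \meet_(eta in Con B | `[< absorbing w eta >]) eta.

Lemma ConP t : reflect (congruence B t) (t \in Con B).
Proof. by rewrite inE; apply: asboolP. Qed.

Lemma fullP w S : reflect (forall i, (i < size w)%N -> S i) (full w S).
Proof.
apply: (iffP allP) => h i; first by move=> ilt; apply: h; rewrite mem_iota.
by rewrite mem_iota => /h.
Qed.

Lemma cubes_full w h S : cubes w h -> full w S -> h S = h xpredT.
Proof.
move=> hC /fullP fS; elim: hC => [_ [i [x [y [ilt _ ->]]]]|//|s g _ IH].
  by rewrite fS.
by congr op; apply: eq_from_tnth => j; rewrite !tnth_mktuple.
Qed.

Lemma wcomm_Con w : wcomm w \in Con B.
Proof.
apply/ConP => s x y xy; apply/meets_eqvP => t /= Pt; case/andP: (Pt) => /ConP ct _.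
by apply: (ct) => i; apply: (elimT (meets_eqvP _ _ _) (xy i)).
Qed.

Lemma wcommP w eta : eta \in Con B -> (wcomm w <= eta <-> absorbing w eta).
Proof.
move=> Ceta; split=> [/leP_eqv le h c hC hc|Aeta]; last first.
  by apply: meets_inf; rewrite Ceta; apply/asboolP.
apply: le; apply/meets_eqvP => t /= /andP[_ /asboolP At]; exact: At.
Qed.

(** A cube over [w'] restricts to a cube over [w] along an injection of the
    positions of [w] into those of [w'], by choosing [b_j] at the positions [j]
    that are not hit. *)
Lemma wcomm_reindex w w' (phi : nat -> nat) :
    (forall i, (i < size w)%N ->
       (phi i < size w')%N && (nth \bot w' (phi i) <= nth \bot w i)) ->
    {in gtn (size w) &, injective phi} ->
  wcomm w' <= wcomm w.
Proof.
move=> phiP phiI; apply/wcommP; first exact: wcomm_Con.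
move=> h c hC hc.
pose psi S j := if [pick i : 'I_(size w) | phi i == j] is Some i then S i else true.
have psiE S i : (i < size w)%N -> psi S (phi i) = S i.
  move=> ilt; rewrite /psi; case: pickP => [i' /eqP|/(_ (Ordinal ilt))].
    by move=> e; rewrite (phiI i' i) ?inE.
  by rewrite /= eqxx.
have psiT : psi xpredT = xpredT.
  by apply/funext => j; rewrite /psi; case: pickP.
have psiC : cubes w (h \o psi).
  apply: (generated_comp _ hC) => _ [j [x [y [jlt jxy ->]]]].
  rewrite /comp /psi; case: pickP => [i /eqP ij|_]; last exact: gen_const.
  apply: gen_base; exists i, x, y; split=> //.
  have /andP[_ /leP_eqv] := phiP i (ltn_ord i); apply.
  by rewrite ij.
have := (wcommP w (wcomm_Con w)).1 (lexx _) _ c psiC.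
rewrite /= psiT; apply=> S nfS; apply: hc; apply: contra nfS => /fullP fS.
apply/fullP => i ilt; rewrite -psiE //; apply: fS.
by case/andP: (phiP i ilt).
Qed.

Lemma wcomm_perm w w' : perm_eq w w' -> wcomm w = wcomm w'.
Proof.
have le u u' : perm_eq u u' -> wcomm u' <= wcomm u.
  move=> uu'; have /(perm_iotaP \bot)[Is IsP uE] := uu'.
  have sIs : size Is = size u' by rewrite (perm_size IsP) size_iota.
  have uIs : uniq Is by rewrite (perm_uniq IsP) iota_uniq.
  have su : size u = size Is by rewrite uE size_map.
  apply: (@wcomm_reindex u u' (nth 0 Is)) => [i|i j].
    rewrite su => ilt; have : nth 0 Is i \in Is by apply: mem_nth.
    rewrite (perm_mem IsP) mem_iota add0n => /andP[_ ->] /=.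
    by rewrite uE (nth_map 0).
  by rewrite !inE su => ilt jlt /eqP; rewrite nth_uniq // => /eqP.
by move=> ww'; apply/le_anti; rewrite !le // perm_sym.
Qed.

Lemma wcomm_cons t w : wcomm (t :: w) <= wcomm w.
Proof.
apply: (@wcomm_reindex w (t :: w) succn) => [i ilt|i j _ _ [//]].
by rewrite /= ltnS ilt lexx.
Qed.

Lemma wcomm_le s t w : s <= t -> wcomm (s :: w) <= wcomm (t :: w).
Proof.
move=> st; apply: (@wcomm_reindex _ _ id) => [[|i] ilt|i j _ _ //].
  by rewrite /= st.
by rewrite /= lexx andbT.
Qed.

Lemma wcomm_letter t w : t \in Con B -> wcomm (t :: w) <= t.
Proof.
move=> Ct; apply: (@le_trans _ _ (wcomm [:: t])).
  apply: (@wcomm_reindex _ _ id) => [[|i] //= _|i j _ _ //].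
apply/wcommP => // h c hC hc.
rewrite -(hc xpred0); last by apply/fullP => /(_ 0 isT).
apply: congruence_generated hC; first exact/ConP.
by move=> _ [[|i] [x [y [//= _ txy ->]]]].
Qed.

Section Malcev.
Variables (d : A -> A -> A -> A) (dP : malcev_operation B d).

Let dxxy x y : d x x y = y. Proof. by case: dP. Qed.
Let dyxx x y : d y x x = y. Proof. by case: dP. Qed.
Let dcubes w g1 g2 g3 : cubes w g1 -> cubes w g2 -> cubes w g3 ->
  cubes w (fun S => d (g1 S) (g2 S) (g3 S)).
Proof. by case: dP => _ _; apply; apply: generated_closed. Qed.

Definition remove i S : nat -> bool := fun j => (j != i) && S j.

Lemma remove_id i S : S i = false -> remove i S = S.
Proof.
by move=> Si; apply/funext => j; rewrite /remove; case: eqVneq => [->|].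
Qed.

Lemma removeC i j S : remove i (remove j S) = remove j (remove i S).
Proof. by apply/funext => k; rewrite /remove andbCA. Qed.

Lemma cubes_remove w i h : cubes w h -> cubes w (h \o remove i).
Proof.
move=> hC; apply: (generated_comp _ hC) => _ [j [x [y [jlt jxy ->]]]].
rewrite /comp /remove; case: (j != i) => /=; last exact: gen_const.
by apply: gen_base; exists j, x, y.
Qed.

(** [correct c s h] takes the value [c] at every vertex that misses an element
    of [s]: the step for [i] does so for the vertices that miss [i] and keeps
    the values [c] produced by the other steps. *)
Definition correct c (s : seq nat) (h : (nat -> bool) -> A) :=
  foldr (fun i g S => d (g S) (g (remove i S)) c) h s.

Lemma cubes_correct w c s h : cubes w h -> cubes w (correct c s h).
Proof.
move=> hC; elim: s => //= i s IH; apply: dcubes => //; last exact: gen_const.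
exact: cubes_remove IH.
Qed.

Lemma correct_miss c s h S : ~~ all S s -> correct c s h S = c.
Proof.
elim: s S => //= i s IH S; case Si: (S i) => /= nS; last by rewrite remove_id.
rewrite !IH //; apply: contra nS => /allP h'.
by apply/allP => j /h' /andP[].
Qed.

Lemma correct_stable c s h (P : (nat -> bool) -> Prop) :
    (forall i S, P S -> P (remove i S)) -> (forall S, P S -> h S = c) ->
  forall S, P S -> correct c s h S = c.
Proof. by move=> Pr Ph; elim: s => //= i s IH S PS; rewrite !IH //; apply: Pr. Qed.

(** Used with [phi] the identity or [remove 0], to carry a common face of two
    cubes over to their corrections. *)
Lemma correct_eq c s h h' (P : (nat -> bool) -> Prop) phi :
    (forall i S, i \in s -> P S -> P (remove i S)) ->
    (forall i S, phi (remove i S) = remove i (phi S)) ->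
    (forall S, P S -> h S = h' (phi S)) ->
  forall S, P S -> correct c s h S = correct c s h' (phi S).
Proof.
move=> + phiC Ph; elim: s => //= i s IH Pr S PS.
have {}IH := IH (fun j S' js => Pr j S' (mem_behead (s := i :: s) js)).
by rewrite !IH ?phiC //; apply: Pr; rewrite ?mem_head.
Qed.

Lemma correct_mod w c s h eta : eta \in Con B ->
    {subset s <= gtn (size w)} ->
    (forall S, ~~ full w S -> eta c (h S)) ->
  forall S, eta (h S) (correct c s h S).
Proof.
move=> /ConP Ceta sub hc; elim: s sub => [|i s IH] sub S /=.
  exact: eqv_refl.
have {}IH S' : eta (h S') (correct c s h S').
  by apply: IH => j js; apply: sub; rewrite inE js orbT.
apply: (eqv_trans (IH S)).
rewrite -{1}[correct c s h S](dyxx c); apply: (malcev_congruence dP) => //;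
  try exact: eqv_refl.
apply: eqv_trans (IH _); apply: hc; apply/fullP => /(_ i).
rewrite /remove eqxx; suff -> : (i < size w)%N by move/(_ isT).
by apply: sub; rewrite mem_head.
Qed.

(** A cube that is constant only modulo [eta] is congruent to its correction,
    which is constant. *)
Lemma absorbing_mod w eta h c : eta \in Con B -> absorbing w eta ->
    cubes w h -> (forall S, ~~ full w S -> eta c (h S)) ->
  eta c (h xpredT).
Proof.
move=> Ceta Aeta hC hc; pose s := iota 0 (size w).
have sub : {subset s <= gtn (size w)} by move=> i; rewrite mem_iota.
have := correct_mod Ceta sub hc xpredT; rewrite eqv_sym.
apply: eqv_trans; apply: Aeta; first exact: cubes_correct.
by move=> S; apply: correct_miss.
Qed.

Lemma cubes_edge_split w h (s t : equivalence A) :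
    s \in Con B -> t \in Con B -> cubes (s `|` t :: w) h ->
  exists g1 g2, [/\ cubes (s :: w) g1, cubes (t :: w) g2,
    forall S, ~~ S 0 -> g1 S = h S, forall S, S 0 -> g1 S = g2 (remove 0 S)
    & forall S, S 0 -> g2 S = h S].
Proof.
move=> /ConP cs /ConP ct; elim=> [_ [[|i] [x [y [ilt xy ->]]]]|c|o g _ IH].
- have [z sxz tzy] := join_congruence_comp dP cs ct xy.
  exists (fun S => if S 0 then z else x), (fun S => if S 0 then y else z).
  split.
  + by apply: gen_base; exists 0, x, z.
  + by apply: gen_base; exists 0, z, y.
  + by move=> S /negPf ->.
  + by move=> S ->; rewrite /remove eqxx.
  + by move=> S ->.
- exists (fun S => if S i.+1 then y else x), (fun S => if S i.+1 then y else x).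
  by split=> //; apply: gen_base; exists i.+1, x, y.
- by exists (fun=> c), (fun=> c); split=> //; apply: gen_const.
- have /choice[g1 /choice[g2 gP]] := IH.
  exists (fun S => op [tuple g1 j S | j < arity o]).
  exists (fun S => op [tuple g2 j S | j < arity o]).
  split; try by apply: gen_op => j; case: (gP j).
  + move=> S nS; congr op; apply: eq_from_tnth => j; rewrite !tnth_mktuple.
    by case: (gP j) => _ _ ->.
  + move=> S nS; congr op; apply: eq_from_tnth => j; rewrite !tnth_mktuple.
    by case: (gP j) => _ _ _ ->.
  + move=> S nS; congr op; apply: eq_from_tnth => j; rewrite !tnth_mktuple.
    by case: (gP j) => _ _ _ _ ->.
Qed.

(** Each edge in the direction of the join is a path of an [s]-edge and a
    [t]-edge, so an absorbing cube in that direction is two cubes [g1], [g2]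
    glued along a common face. Once corrected to be constant off the full
    vertices of the remaining directions, [g1] is absorbing, and [g2] is so
    modulo [wcomm (s :: w)]. *)
Lemma wcomm_join s t w : s \in Con B -> t \in Con B -> s `|` t \in Con B ->
    wcomm (s :: w) `|` wcomm (t :: w) \in Con B ->
  wcomm (s `|` t :: w) = wcomm (s :: w) `|` wcomm (t :: w).
Proof.
move=> Cs Ct Cst Ceta; apply/le_anti/andP; split; last first.
  by rewrite leUx !wcomm_le ?leUl ?leUr.
set eta := wcomm (s :: w) `|` wcomm (t :: w).
move: (leUl _ _ : wcomm (s :: w) <= eta) (leUr _ _ : wcomm (t :: w) <= eta).
rewrite !wcommP // => As At h c hC hc.
have [g1 [g2 [g1C g2C g1h g12 g2h]]] := cubes_edge_split Cs Ct hC.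
pose r := iota 1 (size w); pose g1' := correct c r g1; pose g2' := correct c r g2.
have rem0 i S : i \in r -> S 0 -> remove i S 0.
  by rewrite mem_iota /remove; case: i.
have fullE u S : full (u :: w) S = S 0 && all S r by [].
have g12' S : S 0 -> g1' S = g2' (remove 0 S).
  by apply: (@correct_eq c r g1 g2 (fun S => S 0)) => // i S'; apply: removeC.
have g2'E S : S 0 -> g2' S = correct c r h S.
  exact: (@correct_eq c r g2 h (fun S => S 0) id).
have g1'T : eta c (g1' xpredT).
  apply: As => [|S]; first exact: cubes_correct.
  rewrite fullE negb_and => /orP[nS0|]; last exact: correct_miss.
  apply: (@correct_stable c r g1 (fun S => ~~ S 0)) nS0.
    by move=> i S'; rewrite /remove; apply: contra => /andP[].
  by move=> S' nS'; rewrite g1h // hc // fullE negb_and nS'.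
have g2'T : eta c (g2' xpredT).
  apply: (absorbing_mod Ceta At) => [|S]; first exact: cubes_correct.
  rewrite fullE negb_and; case rS: (all S r); last first.
    by move=> _; rewrite /g2' correct_miss ?rS ?eqv_refl.
  rewrite orbF => nS0.
  (* The remaining vertex lies on the face shared with [g1]. *)
  pose S' j := (j == 0) || S j.
  have -> : S = remove 0 S'.
    apply/funext => j; rewrite /remove /S'; case: j => //=.
    exact: negPf.
  rewrite -/g2' -g12' // /g1' (cubes_full (cubes_correct c r g1C)) //.
  rewrite fullE /=.
  by apply: sub_all rS => j Sj; rewrite /S' Sj orbT.
apply: (eqv_trans g2'T); rewrite g2'E // eqv_sym.
apply: (@correct_mod (s `|` t :: w)) => // [i|S nS].
  by rewrite mem_iota add1n !inE ltnS => /andP[].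
by rewrite hc ?eqv_refl.
Qed.

(** If [t = [t, t]], then [t] is generated by the pairs [(c, k xpredT)] where [k]
    is a square over [[:: t; t]] with value [c] off the top. So every edge in
    the direction of [t] extends to a square that is constant off its top, and
    a cube over [t :: w] that is constant off its top yields one over
    [t :: t :: w] with the same top and the same constant. *)
Lemma wcomm_dup t w : wcomm [:: t; t] = t -> wcomm (t :: t :: w) = wcomm (t :: w).
Proof.
move=> tt; apply/le_anti; rewrite wcomm_cons /=; apply/wcommP.
  exact: wcomm_Con.
(* By the Mal'cev identities the pairs that can be placed on the square of the
   first two directions form a congruence [u]. *)
pose R x y := cubes (t :: t :: w) (fun S => if S 0 && S 1 then y else x).
have Rr x : R x x.
  have -> : R x x = cubes (t :: t :: w) (fun=> x); last exact: gen_const.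
  by congr cubes; apply/funext => S; case: ifP.
have Rcl : op_closed B (fun g : bool -> A => R (g false) (g true)).
  move=> o g Rg; pose G j S := if S 0 && S 1 then g j true else g j false.
  have := gen_op (g := G) Rg; congr cubes; apply/funext => S.
  by rewrite /G; case: ifP.
have [u /ConP Cu uR] := reflexive_closed_congruence dP Rr Rcl.
have /leP_eqv tu : t <= u.
  rewrite -tt; apply/wcommP => // h c hC hc; apply/uR.
  have : cubes (t :: t :: w) h.
    elim: hC => [g [i [x [y [ilt xy gE]]]]|k|o g _ IH].
    - apply: gen_base; exists i, x, y; split=> //.
        by apply: leq_trans ilt _.
      by case: i ilt xy {gE} => [|[|i]].
    - exact: gen_const.
    - exact: gen_op.
  congr cubes; apply/funext => S.
  have fE : full [:: t; t] S = S 0 && S 1 by rewrite /full /= andbT.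
  rewrite -fE; case: ifPn => [|/hc //].
  exact: cubes_full hC.
move=> h c hC hc.
(* The first two positions of [t :: t :: w] are merged by conjunction. *)
pose phi S j := if j is j'.+1 then S j'.+2 else S 0 && S 1.
have phiC : cubes (t :: t :: w) (h \o phi).
  apply: (generated_comp _ hC) => _ [[|i] [x [y [ilt xy ->]]]].
    exact/uR/tu.
  by apply: gen_base; exists i.+2, x, y.
have phiT : phi xpredT = xpredT by apply/funext; case.
have /(_ (h \o phi) c phiC) := (wcommP _ (wcomm_Con (t :: t :: w))).1 (lexx _).
rewrite /= phiT; apply=> S nS; apply: hc; apply: contra nS => /fullP fS.
apply/fullP => -[|[|i]] ilt.
- by have := fS 0 isT; rewrite /phi => /andP[].
- by have := fS 0 isT; rewrite /phi => /andP[].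
- exact: (fS i.+1).
Qed.

Section Higher.
Variables (n : nat) (alpha : 'I_n.+1 -> equivalence A).
Let w := [seq alpha i | i <- enum 'I_n.+1].

Let size_w : size w = n.+1.
Proof. by rewrite size_map size_enum_ord. Qed.

Let nth_w (i : 'I_n.+1) : nth \bot w i = alpha i.
Proof. by rewrite (nth_map i) ?size_enum_ord // nth_ord_enum. Qed.

Let vset S : {set 'I_n.+1} := [set i | S (val i)].

Let vsetT S : full w S = (vset S == [set: 'I_n.+1]).
Proof.
apply/fullP/eqP => [fS|vS i].
  by apply/setP => i; rewrite !inE fS // size_w ltn_ord.
rewrite size_w => ilt; have := in_setT (Ordinal ilt).
by rewrite -vS inE.
Qed.

(** One system of blocks serves all cubes: every block has a variable for each
    pair [(x, y)] of elements, assigned the values [x] and [y] when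
    [alpha i x y], and [x] twice otherwise. *)
Let k (_ : 'I_n.+1) : nat := #|{: A * A}|.
Let a (i : 'I_n.+1) : (k i).-tuple A := [tuple (enum_val j).1 | j < k i].
Let b (i : 'I_n.+1) : (k i).-tuple A :=
  [tuple let u := enum_val j in if alpha i u.1 u.2 then u.2 else u.1 | j < k i].

Lemma cubes_peval h : cubes w h ->
  exists f : polynomial B (blocks k), forall S, h S = peval f (vertex a b (vset S)).
Proof.
elim=> [_ [i [x [y [ilt xy ->]]]]|c|o g _ IH].
- rewrite size_w in ilt; pose i' := Ordinal ilt.
  exists (Var _ (inl (Tagged (fun i => 'I_(k i)) (enum_rank (x, y) : 'I_(k i'))))).
  have {}xy : alpha i' x y by rewrite -nth_w.
  move=> S; rewrite /peval /= /vertex /= inE /=.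
  by case: (S i); rewrite tnth_mktuple enum_rankK //= xy.
- by exists (Var _ (inr c)).
- have /choice[f fP] := IH; exists (App f) => S.
  by rewrite /peval /=; congr op; apply: eq_from_tnth => j; rewrite !tnth_mktuple.
Qed.

Lemma peval_cubes k' (f : polynomial B (blocks k')) a' b' :
    (forall i j, alpha i (tnth (a' i) j) (tnth (b' i) j)) ->
  cubes w (fun S => peval f (vertex a' b' (vset S))).
Proof.
move=> ab.
pose v (l : blocks k' + A) S :=
  match l with inl x => vertex a' b' (vset S) x | inr c => c end.
apply: (@closed_eval A B _ (cubes w) _ v f); first exact: generated_closed.
case=> [[i j]|c] /=; last exact: gen_const.
apply: gen_base; exists i, (tnth (a' i) j), (tnth (b' i) j).
rewrite size_w nth_w; split=> //; apply/funext => S.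
by rewrite /v /vertex /= /vset inE; case: (S i).
Qed.

(** The condition on [f] compares the two values along the last direction;
    [d(f(x, x_n), f(x, b_n), f(b, b_n))] turns it into an absorption condition
    for the vertex [(b_1, ..., b_(n-1), a_n)], and exchanging [a_n] with [b_n]
    moves this vertex to the full one. *)
Lemma centralizes_absorbing eta : eta \in Con B ->
  centralizes B alpha eta <-> absorbing w eta.
Proof.
move=> Ceta; split=> [cent h c hC hc|Aeta k' f a' b' ab hf].
  have [f fP] := cubes_peval hC.
  have ab i j : alpha i (tnth (a i) j) (tnth (b i) j).
    by rewrite !tnth_mktuple /=; case: ifP => // _; apply: eqv_refl.
  pose ch (T : {set 'I_n.+1}) (j : nat) := (j < n.+1)%N && (inord j \in T).
  have chK T : vset (ch T) = T.
    by apply/setP => i; rewrite inE /ch ltn_ord inord_val.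
  have fE T : T != setT -> peval f (vertex a b T) = c.
    by move=> TT; rewrite -(chK T) -fP hc // vsetT chK.
  have m1 : [set~ ord_max] != [set: 'I_n.+1].
    by apply/eqP => /setP/(_ ord_max); rewrite !inE eqxx.
  have := cent k f a b ab; rewrite fE // fP.
  have -> : vset xpredT = setT by apply/setP => i; rewrite !inE.
  apply=> T pT.
  have ncT : T != setT.
    by apply: contraTneq pT => ->; rewrite properE subTset (negPf m1).
  rewrite !fE ?eqv_refl //; apply: contraTneq pT => /setP mT.
  rewrite properE; apply/negP => /andP[_] /negP; apply.
  apply/subsetP => i; rewrite !inE => /negPf im.
  by have := mT i; rewrite !inE im.
have := peval_cubes f ab; set g := (fun S => _) => gC.
pose add S j := (j == n) || S j.
pose flip S j := if j == n then ~~ S j else S j.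
have addC : cubes w (g \o add).
  apply: (generated_comp _ gC) => _ [j [x [y [jlt jxy ->]]]].
  rewrite /comp /add; case: (j == n) => /=; first exact: gen_const.
  by apply: gen_base; exists j, x, y.
pose h S := d (g S) (g (add S)) (g xpredT).
have hC : cubes w (h \o flip).
  have : cubes w h by apply: dcubes => //; apply: gen_const.
  apply: (@generated_comp A B _ _ flip) => _ [j [x [y [jlt jxy ->]]]].
  rewrite /comp /flip; case: (j == n).
    apply: gen_base; exists j, y, x; split=> //; first by rewrite eqv_sym.
    by apply/funext => S; rewrite if_neg.
  by apply: gen_base; exists j, x, y.
have vmax S : (ord_max \in vset S) = S n by rewrite inE.
have vadd S : vset (add S) = ord_max |: vset S.
  by apply/setP => i; rewrite !inE /add.
have gT : g xpredT = peval f (vertex a' b' [set: 'I_n.+1]).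
  by rewrite /g; congr (peval f (vertex a' b' _)); apply/setP => i; rewrite !inE.
have vflip : vset (flip xpredT) = [set~ ord_max].
  by apply/setP => i; rewrite !inE /flip -val_eqE /=; case: (_ == n).
have gm : h (flip xpredT) = peval f (vertex a' b' [set~ ord_max]).
  rewrite /h; have -> : g (add (flip xpredT)) = g xpredT.
    congr g; apply/funext => j; rewrite /add /flip; by case: eqP.
  by rewrite dyxx /g vflip.
rewrite -gT -gm eqv_sym; apply: (absorbing_mod Ceta Aeta hC) => S nfS /=.
rewrite /h; set S' := flip S.
case S'n : (S' n).
  have -> : add S' = S'.
    by apply/funext => j; rewrite /add; case: eqP => // ->; rewrite S'n.
  by rewrite dxxy eqv_refl.
suff e : eta (g S') (g (add S')).
  rewrite -{1}(dxxy (g (add S')) (g xpredT)).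
  move/ConP: Ceta => ?; apply: (malcev_congruence dP) => //; try exact: eqv_refl.
  by rewrite eqv_sym.
rewrite /g vadd; apply: hf; rewrite properE; apply/andP; split.
  apply/subsetP => i; rewrite !inE => Si; apply: contraTneq Si => ->.
  by rewrite /= S'n.
apply: contra nfS => /subsetP sub; apply/fullP => j; rewrite size_w => jlt.
have Sn : S n by move: S'n; rewrite /S' /flip eqxx => /negbFE.
case: (eqVneq j n) => [->//|jn].
have := sub (Ordinal jlt); rewrite !inE /S' /flip /= (negPf jn); apply.
by apply: contra jn => /eqP [->].
Qed.

Lemma commutator_wcomm : commutator B alpha = wcomm w.
Proof.
rewrite /commutator /wcomm; apply: eq_bigl => eta.
case Ceta : (eta \in Con B) => //=.
by apply/asboolP/asboolP => h; apply/centralizes_absorbing.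
Qed.

End Higher.
End Malcev.
End Cubes.

(** * Non-principal ultrafilters and Dickson's lemma *)

Lemma infinite_ultrafilter (X : Type) (D : set X) : infinite_set D ->
  exists G : set_system X,
    [/\ UltraFilter G, G D & forall E, finite_set E -> ~ G E].
Proof.
move=> Dinf; pose F : set_system X := [set E | finite_set (D `\` E)]%classic.
have F_proper : ProperFilter F.
  split; first by rewrite /F /= classical_sets.setD0.
  split=> [|E E' FE FE'|E E' EE' FE].
  - by rewrite /F /= classical_sets.setDT; apply: finite_set0.
  - by rewrite /F /= classical_sets.setDIr finite_setU.
  - by apply: sub_finite_set FE; apply: classical_sets.setDS.
have [G [GU FG]] := ultraFilterLemma F_proper.
have GD : G D by apply: FG; rewrite /F /= classical_sets.setDv; apply: finite_set0.
exists G; split=> // E Efin GE.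
have GC : G (~` E)%classic.
  by apply: FG; apply: sub_finite_set Efin => x [_ /contrapT].
have /filter_ex[x [//]] : G (E `&` ~` E)%classic by apply: filterI.
Qed.

(** Almost every is meant along a non-principal ultrafilter on a supposedly
    infinite set of minimal elements. A coordinate is either almost constant or
    exceeds any given bound almost always; in both cases almost every [x] is
    below almost every [z] in this coordinate. As there are finitely many
    coordinates, some two distinct minimal elements are comparable. *)
Lemma dickson (T : finType) (U : set {ffun T -> nat}) :
  finite_set [set x | U x /\
    forall z, U z -> (forall t, z t <= x t) -> z = x]%classic.
Proof.
apply: contrapT => /infinite_ultrafilter; set D := (X in _ X).
case=> G [GU GD Gfin].
have coord t : G [set x : {ffun T -> nat} |
    G [set z : {ffun T -> nat} | x t <= z t]]%classic.
  pose above c := G [set z : {ffun T -> nat} | c <= z t]%classic.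
  case: (pselect (forall c, above c)) => [all_above|/existsNP[c nc]].
    by apply: filterS filterT => x _; apply: all_above.
  have ex : exists c, ~~ `[< above c >] by exists c; apply/asboolP.
  case: (ex_minnP ex) => -[|c'] /asboolP nc' min_c.
    by case: nc'; apply: filterS filterT.
  have ac' : above c'.
    by apply: contrapT => /asboolPn/min_c; rewrite ltnn.
  have [/nc' //|] := in_ultra_setVsetC
    [set z : {ffun T -> nat} | c' < z t]%classic GU.
  apply: filterS => x /negP; rewrite -leqNgt => xc'.
  by apply: filterS ac' => z; apply: leq_trans.
have coords : G [set x : {ffun T -> nat} |
    forall t, G [set z : {ffun T -> nat} | x t <= z t]]%classic.
  exact: filter_forall.
have [x [Dx xG]] := filter_ex (filterI GD coords).
have above_x : G [set z : {ffun T -> nat} | forall t, x t <= z t]%classic.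
  exact: filter_forall.
have not_x : G (~` [set x])%classic.
  by have [/(Gfin _ (finite_set1 x))|//] := in_ultra_setVsetC [set x]%classic GU.
have [z [[Dz zx] xz]] := filter_ex (filterI (filterI GD not_x) above_x).
by case: zx; apply/esym; case: Dz => _; apply => //; case: Dx.
Qed.

Lemma minimal_below (T : finType) (U : set {ffun T -> nat}) z : U z ->
  exists2 x : {ffun T -> nat}, U x /\
    (forall z', U z' -> (forall t, z' t <= x t) -> z' = x)
    & forall t, x t <= z t.
Proof.
have [n] := ubnP (\sum_t z t); elim: n z => // n IH z zn Uz.
case: (pselect (forall z', U z' -> (forall t, z' t <= z t) -> z' = z)).
  by exists z.
move=> /existsNP[z' /not_implyP[Uz' /not_implyP[z'z ne]]].
have [|x [Ux xmin] xz'] := IH z' _ Uz'; last first.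
  by exists x => // t; apply: leq_trans (z'z t).
rewrite ltnS in zn; apply: leq_trans zn; rewrite ltn_neqAle leq_sum ?andbT //.
apply: contra_not_neq ne => /eqP sum_eq; apply/ffunP => t.
have [_] := leqif_sum (fun t (_ : xpredT t) => leqif_eq (z'z t)).
by rewrite sum_eq => /esym/forallP/(_ t)/eqP.
Qed.

(** * Admissible sequences of operations on a lattice of equivalences *)

Section Admissible.
Variables (A : finType) (L : {set equivalence A}).
Local Open Scope order_scope.
Notation T := (equivalence A).
Implicit Types (f : seq T -> T) (g s t p q y : T) (u v w : seq T).

(** The part of the theory of higher commutators in Mal'cev algebras that the
    argument needs; [f [:: t_1; ...; t_n]] stands for [[t_1, ..., t_n]]. *)
Record admissible f : Prop := Admissible {
  adm_in w : f w \in L;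
  adm_perm w w' : perm_eq w w' -> f w = f w';
  adm_cons t w : f (t :: w) <= f w;
  adm_letter t w : t \in L -> f (t :: w) <= t;
  adm_join s t w : s \in L -> t \in L ->
    f (s `|` t :: w) = f (s :: w) `|` f (t :: w);
  adm_dup t w : f [:: t; t] = t -> f (t :: t :: w) = f (t :: w) }.

Definition splits_at (delta epsilon : T) : Prop :=
  [/\ delta \in L, epsilon \in L, bot_of L < epsilon <= delta, delta < top_of L
    & forall g, g \in L -> g <= delta \/ epsilon <= g].

Definition join_irreducible y : Prop :=
  forall s t, s \in L -> t \in L -> y = s `|` t -> y = s \/ y = t.

Section Theory.
Variables (f : seq T -> T) (fP : admissible f).

Lemma adm_catr u w : f (u ++ w) <= f w.
Proof. by elim: u => //= t u; apply: le_trans (adm_cons fP _ _). Qed.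

Lemma adm_catl u w : f (u ++ w) <= f u.
Proof.
have -> : f (u ++ w) = f (w ++ u) by apply: adm_perm => //; rewrite perm_catC.
exact: adm_catr.
Qed.

Lemma adm_le s t w : s \in L -> t \in L -> s <= t -> f (s :: w) <= f (t :: w).
Proof. by move=> Ls Lt /join_r <-; rewrite adm_join // leUl. Qed.

Lemma adm_count u w : (forall t, (count_mem t u <= count_mem t w)%N) -> f w <= f u.
Proof.
move=> /count_subseqP[u' /perm_to_subseq[r wr] uu'].
by rewrite (adm_perm fP wr) (adm_perm fP uu') adm_catl.
Qed.

Lemma adm_nseq_le k s t w : s \in L -> t \in L -> s <= t ->
  f (nseq k s ++ w) <= f (nseq k t ++ w).
Proof.
move=> Ls Lt st; elim: k w => //= k IH w.
apply: (le_trans (adm_le _ Ls Lt st)).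
have E r : f (t :: nseq k r ++ w) = f (nseq k r ++ t :: w).
  by apply: adm_perm => //; rewrite -(cat1s t (_ ++ _)) -(cat1s t w) perm_catCA.
by rewrite !E.
Qed.

(** Expanding [n] copies of [s `|` t] yields words with many [s] or many [t]. *)
Lemma adm_nseq_join k1 k2 s t w (m : T) : s \in L -> t \in L ->
    f (nseq k1 s ++ w) <= m -> f (nseq k2 t ++ w) <= m ->
  forall n i j, (k1 + k2 <= n + i + j)%N ->
    f (nseq n (s `|` t) ++ nseq i s ++ nseq j t ++ w) <= m.
Proof.
move=> Ls Lt sm tm; elim=> [|n IH] i j.
  rewrite add0n => ij; case: (leqP k1 i) => [k1i|ik1].
    apply: le_trans sm; apply: adm_count => r; rewrite !count_cat !count_nseq.
    by case: (pred1 r s) => /=; lia.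
  apply: le_trans tm; apply: adm_count => r; rewrite !count_cat !count_nseq.
  by case: (pred1 r t) => /=; lia.
move=> nij /=; rewrite adm_join // leUx; apply/andP; split.
  have /IH : (k1 + k2 <= n + i.+1 + j)%N by lia.
  apply: le_trans; rewrite (adm_perm fP
    (w' := nseq n (s `|` t) ++ nseq i.+1 s ++ nseq j t ++ w)) //.
  by apply/permP => a; do 2!rewrite /= !count_cat; rewrite /=; lia.
have /IH : (k1 + k2 <= n + i + j.+1)%N by lia.
apply: le_trans; rewrite (adm_perm fP
  (w' := nseq n (s `|` t) ++ nseq i s ++ nseq j.+1 t ++ w)) //.
by apply/permP => a; do 2!rewrite /= !count_cat; rewrite /=; lia.
Qed.

End Theory.

Hypothesis sublattice_L : sublattice L.
Hypothesis modular_L : forall s t u : T, s \in L -> t \in L -> u \in L ->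
  s <= u -> u `&` (s `|` t) <= s `|` (u `&` t).

Section Splitting.
Variables (f : seq T -> T) (fP : admissible f) (y m : T).
Hypotheses (Ly : y \in L) (Lm : m \in L) (yJI : join_irreducible y).
Hypotheses (y_abelian : f [:: y; y] <> y).
Hypotheses (y_frequent : forall k, ~~ (f (nseq k y) <= m)).

(** The letters that may be repeated without bound in front of [v]. *)
Let frequent v : {set T} :=
  [set p in L | `[< forall k, ~~ (f (nseq k p ++ v) <= m) >]].

Let frequentP v p :
  reflect (p \in L /\ forall k, ~~ (f (nseq k p ++ v) <= m)) (p \in frequent v).
Proof. by rewrite inE; apply: (iffP andP) => -[Lp /asboolP]. Qed.

Let frequent_cat u v : frequent (u ++ v) \subset frequent v.
Proof.
apply/subsetP => p /frequentP[Lp pf]; apply/frequentP; split=> // k.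
apply: contra (pf k); apply: le_trans; apply: adm_count => // t.
by rewrite !count_cat; lia.
Qed.

Let frequent_cons p v : p \in frequent v -> p \in frequent (p :: v).
Proof.
move=> /frequentP[Lp pf]; apply/frequentP; split=> // k.
apply: contra (pf k.+1); apply: le_trans; apply: adm_count => // t.
by rewrite /= !count_cat /=; lia.
Qed.

Let frequent_stable : exists v, [/\ y \in v, frequent v != set0
  & forall u, frequent (u ++ v) != set0 -> frequent (u ++ v) = frequent v].
Proof.
suff h n : forall v, y \in v -> frequent v != set0 -> (#|frequent v| <= n)%N ->
    exists v, [/\ y \in v, frequent v != set0
      & forall u, frequent (u ++ v) != set0 -> frequent (u ++ v) = frequent v].
  apply: (h _ [:: y]); last exact: leqnn; first by rewrite mem_head.
  apply/set0Pn; exists y; apply: frequent_cons; apply/frequentP; split=> // k.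
  by rewrite cats0.
elim: n => [|n IH] v yv v0 vn; first by rewrite -cards_eq0 -leqn0 vn in v0.
case: (pselect (forall u, frequent (u ++ v) != set0 ->
  frequent (u ++ v) = frequent v)); first by exists v.
move/existsNP => -[u /not_implyP[u0 /eqP une]].
apply: (IH (u ++ v)) => //; first by rewrite mem_cat yv orbT.
rewrite -ltnS; apply: leq_trans vn; apply: proper_card.
by rewrite properEneq une frequent_cat.
Qed.

(** For a suitable [v] the frequent letters [Q] form the complement of an
    ideal of [L], and every word over [Q] may be put in front of [v]. So [L] is
    the union of an ideal [I[0, delta]] and the upset [Q], and [Q] has a lower
    bound outside [I[0, m]], namely the value at a word containing all of [Q].
    The two intervals overlap as required unless [Q] has a least element
    [epsilon]; then [L] still splits unless [epsilon] and [delta] are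
    complements, in which case [epsilon] is an atom with
    [[epsilon, epsilon] = epsilon] below the join irreducible [y], and
    modularity forces [y = epsilon], against [[y, y] <> y]. *)
Lemma frequent_letter_splits : exists delta epsilon, splits_at delta epsilon.
Proof.
have [v [yv /set0Pn[p0 p0Q] stable]] := frequent_stable.
set Q := frequent v in p0Q stable.
have [_ LI LU] := sublattice_L.
have [Lbot botP] := bot_of_least sublattice_L.
have [Ltop topP] := top_of_greatest sublattice_L.
have botm g : g <= bot_of L -> g <= m by move/le_trans; apply; apply: botP.
have QL p : p \in Q -> p \in L by case/frequentP.
have words u : {subset u <= Q} -> frequent (u ++ v) = Q.
  elim: u => // p u IH pu.
  have {}IH : frequent (u ++ v) = Q.
    by apply: IH => q qu; apply: pu; rewrite inE qu orbT.
  apply: (stable (p :: u)); apply/set0Pn; exists p.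
  by apply: frequent_cons; rewrite IH pu ?mem_head.
pose F := f (enum Q ++ v).
have FL : F \in L by apply: adm_in.
have Fm : ~~ (F <= m).
  have : p0 \in frequent (enum Q ++ v).
    by rewrite words // => q; rewrite mem_enum.
  by case/frequentP => _ /(_ 0).
have letter_le u p : p \in u -> p \in L -> f u <= p.
  by move=> /perm_to_rem /(adm_perm fP) -> Lp; apply: adm_letter.
have Fy : F <= y by apply: letter_le => //; rewrite mem_cat yv orbT.
have FQ q : q \in Q -> F <= q.
  by move=> qQ; apply: letter_le; rewrite ?QL // mem_cat mem_enum qQ.
have upQ p q : p \in Q -> q \in L -> p <= q -> q \in Q.
  move=> /frequentP[Lp pf] Lq pq; apply/frequentP; split=> // k.
  by apply: contra (pf k); apply: le_trans; apply: adm_nseq_le.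
pose D := L :\: Q.
have DP g : g \in D = (g \notin Q) && (g \in L) by rewrite inE.
have botD : bot_of L \in D.
  rewrite DP Lbot andbT; apply/frequentP => -[_ /(_ 1)/negP]; apply.
  by apply: botm; apply: adm_letter.
have sublattice_D : sublattice D.
  split.
  - by apply/set0Pn; exists (bot_of L).
  - move=> s t; rewrite !DP => /andP[sQ Ls] /andP[_ Lt].
    rewrite LI // andbT; apply: contra sQ => stQ.
    by apply: upQ stQ Ls _; rewrite leIl.
  - move=> s t; rewrite !DP => /andP[sQ Ls] /andP[tQ Lt]; rewrite LU // andbT.
    have notQ p : p \in L -> p \notin Q -> exists k, f (nseq k p ++ v) <= m.
      move=> Lp pQ; apply: contrapT => /forallNP h; case/negP: pQ.
      by apply/frequentP; split=> // k; apply/negP.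
    have [k1 sm] := notQ _ Ls sQ; have [k2 tm] := notQ _ Lt tQ.
    apply/frequentP => -[_ /(_ (k1 + k2))/negP]; apply.
    have := @adm_nseq_join _ fP k1 k2 s t v m Ls Lt sm tm (k1 + k2) 0 0.
    by apply; rewrite !addn0.
have [] := top_of_greatest sublattice_D; set delta := top_of D.
rewrite DP => /andP[deltaQ Ldelta] deltaP.
(* The lower bounds of [Q] in [L]; the greatest of them plays the role of the
   meet of [Q]. *)
pose E := [set g in L | [forall q in Q, g <= q]].
have EP g : reflect (g \in L /\ forall q, q \in Q -> g <= q) (g \in E).
  by rewrite inE; apply: (iffP andP) => -[Lg /'forall_implyP].
have sublattice_E : sublattice E.
  split.
  - by apply/set0Pn; exists F; apply/EP.
  - move=> s t /EP[Ls sQ] /EP[Lt tQ]; apply/EP; split; first exact: LI.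
    by move=> q qQ; apply: le_trans (sQ _ qQ); rewrite leIl.
  - move=> s t /EP[Ls sQ] /EP[Lt tQ]; apply/EP; split; first exact: LU.
    by move=> q qQ; rewrite leUx sQ // tQ.
have [] := top_of_greatest sublattice_E; set epsilon := top_of E.
move=> /EP[Leps epsQ] epsP.
have Feps : F <= epsilon by apply: epsP; apply/EP.
have dich g : g \in L -> g <= delta \/ epsilon <= g.
  move=> Lg; case gQ : (g \in Q); first by right; apply: epsQ.
  by left; apply: deltaP; rewrite DP gQ.
have epsm : ~~ (epsilon <= m) by apply: contra Fm; apply: le_trans.
have bot_lt g : g \in L -> ~~ (g <= m) -> bot_of L < g.
  move=> Lg gm; rewrite lt_neqAle botP // andbT; apply: contraNneq gm => <-.
  exact: botm.
have topQ : top_of L \in Q by apply: upQ p0Q Ltop (topP _ (QL _ p0Q)).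
have delta_top : delta < top_of L.
  rewrite lt_neqAle topP // andbT; apply: contraNneq deltaQ => ->; exact: topQ.
case ed : (epsilon <= delta).
  by exists delta, epsilon; split=> //; rewrite ed bot_lt.
have eQ : epsilon \in Q.
  by apply: contraFT ed => eQ; apply: deltaP; rewrite DP eQ.
case: (eqVneq (epsilon `|` delta) (top_of L)) => [join_top|join_ntop]; last first.
  exists (epsilon `|` delta), epsilon; split=> //; first exact: LU.
  - by rewrite bot_lt // leUl.
  - by rewrite lt_neqAle join_ntop topP // LU.
  - move=> g /dich[gd|]; last by right.
    by left; apply: le_trans gd _; rewrite leUr.
case: (eqVneq (epsilon `&` delta) (bot_of L)) => [meet_bot|meet_nbot]; last first.
  exists delta, (epsilon `&` delta); split=> //; first exact: LI.
  - by rewrite lt_neqAle eq_sym meet_nbot botP ?leIr // LI.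
  - move=> g /dich[|eg]; [by left|right].
    by apply: le_trans eg; rewrite leIl.
have below_eps g : g \in L -> g <= epsilon -> ~~ (g <= m) -> epsilon <= g.
  move=> Lg ge gm; have [gd|//] := dich g Lg.
  by case/negP: gm; apply: botm; rewrite -meet_bot lexI ge.
have ey : epsilon <= y.
  apply: le_trans (below_eps F FL Feps Fm) Fy.
have yE : y = epsilon `|` (y `&` delta).
  apply/le_anti/andP; split; last by rewrite leUx ey leIl.
  apply: le_trans (modular_L Leps Ldelta Ly ey).
  by rewrite join_top lexI lexx topP.
have [ye|yd] := yJI Leps (LI _ _ Ly Ldelta) yE.
  case: y_abelian; rewrite ye; apply/le_anti; rewrite adm_letter //=.
  apply: below_eps; [exact: adm_in|exact: adm_letter|].
  have /frequentP[_ /(_ 2)] := eQ.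
  by apply: contra; apply: le_trans; apply: (adm_catl fP [:: epsilon; epsilon]).
by case/negP: (negbT ed); apply: le_trans ey _; rewrite yd leIr.
Qed.

End Splitting.

(** * Families of admissible sequences *)

Section Family.
Variables (I : Type) (F : I -> seq T -> T).
Hypothesis FP : forall i, admissible (F i).

(** The limit exists because [T] is finite, and each axiom of admissible
    sequences involves only finitely many words, on which the limit agrees with
    a member of the family. *)
Let ultra_limit (G : set_system I) : UltraFilter G -> exists2 f, admissible f
  & forall N, G [set i | forall w, (size w <= N)%N -> F i w = f w]%classic.
Proof.
move=> GU.
have /choice[f fG] w : exists c, G [set i | F i w = c]%classic.
  apply: contrapT => /forallNP nG.
  have Gn c : G [set i | F i w <> c]%classic.
    by have [/nG|] := in_ultra_setVsetC [set i | F i w = c]%classic GU.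
  have /filter_ex[i /(_ (F i w))] :
      G [set i | forall c, F i w <> c]%classic by apply: filter_forall.
  exact.
have agree N : G [set i | forall w, (size w <= N)%N -> F i w = f w]%classic.
  have h (n : 'I_N.+1) : G [set i | forall w : n.-tuple T, F i w = f w]%classic.
    by apply: filter_forall => w; apply: fG.
  have : G [set i | forall (n : 'I_N.+1) (w : n.-tuple T), F i w = f w]%classic.
    exact: filter_forall.
  apply: filterS => i hi w wN.
  exact: (hi (Ordinal (wN : (size w < N.+1)%N)) (in_tuple w)).
have ex N : exists i, forall w, (size w <= N)%N -> F i w = f w.
  exact: filter_ex (agree N).
exists f => //; split.
- by move=> w; have [i <-//] := ex (size w); apply: adm_in.
- move=> w w' ww'; have [i h] := ex (size w).
  by rewrite -!h ?(perm_size ww') //; apply: adm_perm.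
- move=> t w; have [i h] := ex (size w).+1.
  by rewrite -!h //; apply: adm_cons.
- move=> t w Lt; have [i h] := ex (size w).+1.
  by rewrite -h //; apply: adm_letter.
- move=> s t w Ls Lt; have [i h] := ex (size w).+1.
  by rewrite -!h //; apply: adm_join.
- move=> t w; have [i h] := ex (size w).+2.
  by rewrite -!h //; apply: adm_dup.
Qed.

(** The successor makes every letter count, so that deleting a letter decreases
    the weight, as does replacing it by a smaller one. *)
Let weight w : nat := \sum_(t <- w) #|graph t|.+1.

Let weight_lt s t w : s < t -> (weight (s :: w) < weight (t :: w))%N.
Proof.
move=> st; rewrite /weight !big_cons ltn_add2r ltnS; apply: proper_card.
rewrite properEneq; apply/andP; split; last exact: ltW st.
by apply: contraTneq st => /val_inj ->; rewrite ltxx.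
Qed.

Let repeated_letter k w : (k * #|{: T}| < size w)%N ->
  exists2 t, t \in w & exists w', perm_eq w (nseq k.+1 t ++ w').
Proof.
move=> kw; have [t tk] : exists t, (k < count_mem t w)%N.
  apply: contrapT => /forallNP small; move: kw; apply/negP; rewrite -leqNgt.
  have -> : size w = \sum_(t : T) count_mem t w.
    rewrite -sum1_size (partition_big id xpredT) //=; apply: eq_bigr => t _.
    exact: sum1_count.
  rewrite mulnC -sum_nat_const; apply: leq_sum => t _.
  by rewrite leqNgt; apply/negP.
exists t; first by rewrite -has_pred1 has_count (leq_trans _ tk).
have /count_subseqP[s /perm_to_subseq[r wr] ts] :
    forall x, (count_mem x (nseq k.+1 t) <= count_mem x w)%N.
  move=> x; rewrite count_nseq /=; case: eqVneq => [<-|//].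
  by rewrite mul1n.
by exists r; apply: (perm_trans wr); rewrite perm_cat2r perm_sym.
Qed.

(** If [F i] agrees with [f] on all words of length at most [N] but not on all
    words, then a word of least weight on which they differ is long, so that
    some letter [y] occurs in it very often. By distributivity, minimality
    makes [y] join irreducible; by [adm_dup] it excludes [[y, y] = y]; and as
    dropping one [y] restores the agreement, the common value at a word with
    still many [y] is not below both of the two different values. *)
Let agreement_or_letter f i k : admissible f ->
    (forall w, (size w <= (k.+1 * #|{: T}|).+2)%N -> F i w = f w) ->
  (forall w, {subset w <= L} -> F i w = f w) \/
  exists y m, [/\ y \in L, m \in L, join_irreducible y, f [:: y; y] <> y
    & ~~ (f (nseq k y) <= m)].
Proof.
move=> fP short; apply/or_asboolP; rewrite -implyNb; apply/implyP => /asboolP none.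
suff h n : forall w, (weight w < n)%N -> {subset w <= L} ->
    F i w <> f w -> exists y m, [/\ y \in L, m \in L, join_irreducible y,
      f [:: y; y] <> y & ~~ (f (nseq k y) <= m)].
  apply/asboolP; move/existsNP: none => -[w /not_implyP[wL wne]].
  exact: h (ltnSn (weight w)) wL wne.
elim: n => // n IH w wn wL wne.
case: (pselect (forall w', (weight w' < weight w)%N -> {subset w' <= L} ->
    F i w' = f w')) => [agree|/existsNP[w' /not_implyP[w'w /not_implyP[w'L w'ne]]]];
  last by apply: (IH w') => //; apply: leq_trans w'w _.
have wlong : (k.+1 * #|{: T}| < size w)%N.
  rewrite ltnNge; apply/negP => ws; apply: wne; apply: short.
  by rewrite (leq_trans ws) // ltnW.
have [y yw [w1 ww]] := repeated_letter wlong.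
have Ly := wL y yw.
set w0 := nseq k y ++ w1; have {}ww : perm_eq w (y :: y :: w0) by [].
have w0L s : s \in L -> {subset s :: y :: w0 <= L}.
  move=> Ls t; rewrite inE => /orP[/eqP -> //|tw]; apply: wL.
  by rewrite (perm_mem ww) inE tw orbT.
have wE : weight w = weight (y :: y :: w0) by apply: perm_big.
have {}wne : F i (y :: y :: w0) <> f (y :: y :: w0).
  by rewrite -(adm_perm fP ww) -(adm_perm (FP i) ww).
have agree1 : F i (y :: w0) = f (y :: w0).
  apply: agree => [|t tw]; last by apply: (w0L y Ly); rewrite inE tw orbT.
  by rewrite wE /weight [X in (_ < X)%N]big_cons addSn ltnS leq_addl.
have yJI : join_irreducible y.
  move=> s t Ls Lt yE; apply: contrapT => /not_orP[ys yt]; apply: wne.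
  have smaller r : r \in L -> r <= y -> y <> r ->
      F i (r :: y :: w0) = f (r :: y :: w0).
    move=> Lr ry yr; apply: agree; last exact: w0L.
    by rewrite wE weight_lt // lt_neqAle ry andbT; apply/eqP => /esym.
  rewrite {1 3}yE (adm_join (FP i)) // (adm_join fP) //.
  by rewrite !smaller // yE ?leUl ?leUr.
have yab : f [:: y; y] <> y.
  move=> yy; apply: wne; rewrite (adm_dup fP) // (adm_dup (FP i)) //.
  by rewrite short.
have letter m : m \in L -> ~~ (f (y :: w0) <= m) ->
    exists y m, [/\ y \in L, m \in L, join_irreducible y, f [:: y; y] <> y
      & ~~ (f (nseq k y) <= m)].
  move=> Lm fm; exists y, m; split=> //; apply: contra fm; apply: le_trans.
  exact: le_trans (adm_cons fP _ _) (adm_catl fP _ _).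
case ffi : (f (y :: y :: w0) <= F i (y :: y :: w0)).
  apply: (letter (f (y :: y :: w0))); first exact: adm_in.
  apply/negP => le; apply: wne; apply/le_anti; rewrite ffi andbT.
  by apply: le_trans le; rewrite -agree1 adm_cons.
apply: (letter (F i (y :: y :: w0))); first exact: adm_in.
by apply: contraFN ffi; apply: le_trans; apply: adm_cons.
Qed.

Hypothesis distinct_F : forall i j, i <> j ->
  exists2 w, {subset w <= L} & F i w <> F j w.

Lemma infinite_family_splits : infinite_set [set: I]%classic ->
  exists delta epsilon, splits_at delta epsilon.
Proof.
move=> /infinite_ultrafilter[G [GU _ Gfin]].
have [f fP agree] := ultra_limit GU.
have letter k : exists ym : T * T, [/\ ym.1 \in L, ym.2 \in L,
    join_irreducible ym.1, f [:: ym.1; ym.1] <> ym.1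
    & ~~ (f (nseq k ym.1) <= ym.2)].
  apply: contrapT => none; pose N := (k.+1 * #|{: T}|).+2.
  have same i : (forall w, (size w <= N)%N -> F i w = f w) ->
      forall w, {subset w <= L} -> F i w = f w.
    move=> /(agreement_or_letter fP)[//|[y [m ym]]].
    by case: none; exists (y, m).
  have /filter_ex[i0 /same i0f] := agree N.
  apply: (Gfin [set i0]%classic); first exact: finite_set1.
  apply: filterS (agree N) => i /same i_f /=; apply: contrapT => ii0.
  by have [w wL] := distinct_F ii0; rewrite i_f // i0f.
have [[y m] ymP] : exists ym : T * T, forall k, [/\ ym.1 \in L, ym.2 \in L,
    join_irreducible ym.1, f [:: ym.1; ym.1] <> ym.1
    & ~~ (f (nseq k ym.1) <= ym.2)].
  apply: contrapT => /forallNP none.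
  have /choice[N NP] ym : exists k, ~ [/\ ym.1 \in L, ym.2 \in L,
    join_irreducible ym.1, f [:: ym.1; ym.1] <> ym.1
    & ~~ (f (nseq k ym.1) <= ym.2)] by apply/existsNP/none.
  have [ym [Ly Lm yJI yab fm]] := letter (\max_ym N ym).
  apply: (NP ym); split=> //; apply: contra fm; apply: le_trans.
  apply: adm_count => // t; rewrite !count_nseq leq_mul2l orbC.
  by rewrite (leq_bigmax ym).
have [Ly Lm yJI yab _] := ymP 0.
apply: (frequent_letter_splits fP Ly Lm yJI yab) => k.
by case: (ymP k).
Qed.

(** A sequence of operations is determined by the sets of words with value at
    most [m], for each [m]. These are upward closed for the order of
    multiplicities of letters, so each has a finite set of minimal elements. *)
Lemma countable_family : countable [set: I]%classic.
Proof.
pose U i (m : T) : set {ffun T -> nat} :=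
  [set x | exists2 w, F i w <= m & forall t, x t = count_mem t w]%classic.
have /choice[b bP] (im : I * T) : exists s : seq {ffun T -> nat},
    [set x | U im.1 im.2 x /\ forall z, U im.1 im.2 z ->
      (forall t, (z t <= x t)%N) -> z = x]%classic = [set` s]%classic.
  exact/finite_seqP/dickson.
have below i m w : F i w <= m <->
    exists2 x : {ffun T -> nat}, x \in b (i, m) & forall t, (x t <= count_mem t w)%N.
  have bE x : x \in b (i, m) <-> U i m x /\ forall z, U i m z ->
      (forall t, (z t <= x t)%N) -> z = x.
    have /seteqP[h h'] := bP (i, m).
    by split=> [/h'|/h].
  split=> [wm|[x /bE[[u um xu] _] xw]].
    have : U i m [ffun t => count_mem t w].
      by exists w => // t; rewrite ffunE.
    case/minimal_below => x /bE bx xw; exists x => // t.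
    by have := xw t; rewrite ffunE.
  by apply: le_trans um; apply: adm_count => // t; rewrite -xu.
apply/countable_injP.
exists (fun i => choice.pickle [ffun m : T => b (i, m)]) => i j _ _.
move=> /(pcan_inj choice.pickleK)/ffunP bij; apply: contrapT => /distinct_F[w _].
apply; have FE m : (F i w <= m) = (F j w <= m).
  have := bij m; rewrite !ffunE => e.
  apply/idP/idP => /below; first by rewrite e => /below.
  by rewrite -e => /below.
by apply/le_anti; rewrite -FE lexx FE lexx.
Qed.

End Family.
End Admissible.

(** * Infinite families of Mal'cev algebras *)

Section Algebras.
Variables (A : finType) (B : algebra A).

Lemma wcomm_admissible : has_malcev_term B -> sublattice (Con B) ->
  admissible (Con B) (wcomm B).
Proof.
move=> /malcev_term_operation[d dP] [_ _ joinC]; split.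
- exact: wcomm_Con.
- exact: wcomm_perm.
- exact: wcomm_cons.
- exact: wcomm_letter.
- move=> s t w Cs Ct; apply: (wcomm_join dP) => //; first exact: joinC.
  by apply: joinC; apply: wcomm_Con.
- exact: wcomm_dup dP.
Qed.

Lemma wcomm_equivalent (B' : algebra A) : has_malcev_term B -> has_malcev_term B' ->
    Con B = Con B' ->
    (forall w, {subset w <= Con B} -> wcomm B w = wcomm B' w) ->
  commutator_equivalent B B'.
Proof.
move=> /malcev_term_operation[d dP] /malcev_term_operation[d' dP'] CC' same.
split=> // n alpha Calpha.
rewrite (commutator_wcomm dP) (commutator_wcomm dP'); apply: same => t.
by move=> /mapP[i _ ->].
Qed.

End Algebras.

Theorem corollary4p6 (A : finType) (I : Type) (L : {set equivalence A})
    (B : I -> algebra A)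
    (infinite_I : infinite_set [set: I]%classic)
    (sublattice_L : sublattice L)
    (malcev_B : forall i : I, has_malcev_term (B i))
    (Con_B : forall i : I, Con (B i) = L)
    (not_equiv_B : forall i j : I, i <> j -> ~ commutator_equivalent (B i) (B j)) :
  countable [set: I]%classic /\
  exists delta epsilon : equivalence A,
    [/\ delta \in L, epsilon \in L,
        (bot_of L < epsilon <= delta)%O, (delta < top_of L)%O
      & L = (interval L (bot_of L) delta :|: interval L epsilon (top_of L))%SET].
Proof.
have admB i : admissible L (wcomm (B i)).
  by rewrite -(Con_B i); apply: wcomm_admissible; rewrite ?Con_B.
have distinct i j : i <> j ->
    exists2 w, {subset w <= L} & wcomm (B i) w <> wcomm (B j) w.
  move=> /not_equiv_B neq; apply: contrapT => same; apply: neq.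
  apply: wcomm_equivalent => // [|w]; rewrite Con_B ?Con_B // => wL.
  by apply: contrapT => ne; apply: same; exists w.
split; first exact: countable_family admB distinct.
have [i0 _] := infinite_setN0 infinite_I.
have modular_L s t u : s \in L -> t \in L -> u \in L -> (s <= u)%O ->
    (u `&` (s `|` t) <= s `|` (u `&` t))%O.
  rewrite -(Con_B i0) => /ConP cs /ConP ct _.
  exact: malcev_modular (malcev_B i0) cs ct.
have [delta [epsilon [Ld Le e1 d1 dich]]] :=
  infinite_family_splits sublattice_L modular_L admB distinct infinite_I.
exists delta, epsilon; split=> //; apply/setP => g.
have [_ botP] := bot_of_least sublattice_L.
have [_ topP] := top_of_greatest sublattice_L.
rewrite !inE; case Lg: (g \in L) => //=.
by rewrite botP // topP // andbT; have [->|->] := dich g Lg; rewrite ?orbT.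
Qed.
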